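(* Let $P$ be a $(\mathbf 3+\mathbf 1)$-free poset on $[n]$ and let $\lambda=(a,1^b)$ be a hook shape. Let $$\mathrm{keyT}_P(\lambda)=\{T\in\mathrm T_P(\lambda)\mid T_{i,1}T_{1,2}T_{1,3}\cdots T_{1,a}\text{ is a powersum word for some }i\in[b+1]\}.$$ Then $\mathrm{powT}_P(\lambda)=\mathrm{keyT}_P(\lambda)$.
   Context: A poset is $(\mathbf 3+\mathbf 1)$-free if it has no induced subposet isomorphic to the disjoint union of a 3-element chain and a 1-element chain. Young diagrams are in English convention. $\mathrm T_P(\lambda)$ is the set of $P$-tableaux of shape $\lambda$, i.e. fillings $T:\lambda\to P$ with $T_{i,j}<_P T_{i+1,j}$ and $T_{i,j}\not>_P T_{i,j+1}$ (entries may repeat). A word $w_1\cdots w_k$ in $P$ is a powersum word if $w_i\not>_P w_{i+1}$ for all $i<k$ and there is no $i<k$ with $w_i<_Pw_j$ for all $j>i$. For a composition $\alpha$ with positive parts, a powerful array of shape $\alpha$ is a filling $A$ of $\{(i,j):1\le j\le\alpha_i\}$ by elements of $P$ such that (1) each row is a powersum word; (2) $A_{r,t}<_PA_{s,t}$ whenever both cells exist and $r<s$; (3) $A_{r,\alpha_r}<_PA_{s,t}$ for all cells $(s,t)$ with $s>r$, $t>\alpha_r$. $\mathrm{tab}(A)$ is the filling of $\mathrm{sort}(\alpha)$ (parts in decreasing order) obtained by pushing the entries of each column upward until top-justified. $\mathrm{powT}_P(\lambda)$ is the set of $P$-tableaux of shape $\lambda$ of the form $\mathrm{tab}(A)$,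 $A$ a powerful array. *)

(* Defs.v *)
From HB Require Import structures.
From mathcomp Require Import all_boot all_order.

Set Implicit Arguments.
Unset Strict Implicit.
Unset Printing Implicit Defensive.

Import Order.TTheory.

(** A filling of the cells {(i, j) : j < alpha_i} is the sequence of its rows,
    with [shape A = alpha]. Rows and columns are numbered from 0, so the cell
    (i, j) of the usual 1-based convention is the cell (i-1, j-1) here. *)

Section Fillings.
Variable T : Type.
Implicit Type A : seq (seq T).

Definition entry A (i j : nat) : option T := obind (fun s => onth s j) (onth A i).

(** Column [j] read from top to bottom, skipping the rows too short to meet it. *)
Definition column A (j : nat) : seq T := pmap (fun s => onth s j) A.

(** For j < lambda_i the entry [onth (column A j) i] always exists, so [pmap]
    drops nothing: see [shape_tab] and [entry_tab]. *)
Definition tab A : seq (seq T) :=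
  let lambda := sort geq (shape A) in
  [seq pmap (fun j => onth (column A j) i) (iota 0 (nth 0 lambda i))
     | i <- iota 0 (size lambda)].

Lemma size_column A j : size (column A j) = count (ltn j) (shape A).
Proof.
rewrite size_pmap /shape count_map; apply: eq_count => s /=.
by rewrite -onthTE; case: onth.
Qed.

Lemma sort_shape_column A i j :
  j < nth 0 (sort geq (shape A)) i -> i < size (column A j).
Proof.
rewrite size_column -(count_sort geq); set l := sort geq (shape A) => lt_j.
have l_sorted : sorted geq l.
  by apply: sort_sorted => m n; apply: leq_total.
have lt_i : i < size l.
  by rewrite ltnNge; apply: contraTN lt_j => le_i; rewrite nth_default.
rewrite -(cat_take_drop i.+1 l) count_cat.
have /eqP-> : count (ltn j) (take i.+1 l) == i.+1.
  rewrite -[X in _ == X](size_takel lt_i) -all_count.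
  apply/(all_nthP 0) => k; rewrite size_takel // => lt_k.
  rewrite nth_take //=; apply: leq_trans lt_j _.
  have geq_tr : transitive geq by move=> y x z /= yx zy; exact: leq_trans yx.
  apply: (sorted_leq_nth geq_tr leqnn 0 l_sorted) => //.
  by rewrite inE; exact: leq_trans lt_k lt_i.
by rewrite leq_addr.
Qed.

Lemma map_row_tab A i :
  let m := nth 0 (sort geq (shape A)) i in
  map Some (pmap (fun j => onth (column A j) i) (iota 0 m)) =
  [seq onth (column A j) i | j <- iota 0 m].
Proof.
move=> m; rewrite pmapS_filter; congr map; apply/all_filterP/allP => j /=.
by rewrite mem_iota add0n => /sort_shape_column; rewrite -onthTE.
Qed.

Lemma shape_tab A : shape (tab A) = sort geq (shape A).
Proof.
rewrite /tab /shape -map_comp -/(shape A); set l := sort geq _.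
rewrite -[RHS](mkseq_nth 0); apply: eq_map => i /=.
by rewrite -(size_map Some) map_row_tab size_map size_iota.
Qed.

Lemma entry_tab A i j :
  j < nth 0 (sort geq (shape A)) i -> entry (tab A) i j = onth (column A j) i.
Proof.
move=> lt_j; have lt_i : i < size (sort geq (shape A)).
  by rewrite ltnNge; apply: contraTN lt_j => le_i; rewrite nth_default.
rewrite /entry /tab onth_map [onth (iota _ _) _]onthE.
rewrite (nth_map 0) ?size_iota // nth_iota //= add0n onthE map_row_tab.
by rewrite (nth_map 0) ?size_iota // nth_iota.
Qed.

End Fillings.

Section PTableaux.
Variables (d : Order.disp_t) (P : porderType d).
Implicit Types (w : seq P) (A T : seq (seq P)) (alpha lambda : seq nat).

Definition three_plus_one_free : Prop :=
  forall x y z w : P, (x < y)%O -> (y < z)%O ->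
    ~ [/\ (w >< x)%O, (w >< y)%O & (w >< z)%O].

Definition is_P_tableau lambda T : Prop :=
  [/\ shape T = lambda,
      (forall i j x y, entry T i j = Some x -> entry T i.+1 j = Some y ->
         (x < y)%O)
    & (forall i j x y, entry T i j = Some x -> entry T i j.+1 = Some y ->
         ~ (x > y)%O)].

Definition powersum_word w : Prop :=
  (forall i x y, onth w i = Some x -> onth w i.+1 = Some y -> ~ (x > y)%O) /\
  ~ (exists i x, [/\ i.+1 < size w, onth w i = Some x
       & forall j y, i < j -> onth w j = Some y -> (x < y)%O]).

Definition is_composition alpha : Prop := all (ltn 0) alpha.

(** In the last clause [(nth 0 alpha r).-1] is the last column of row [r], and
    the columns strictly to its right are those [t] with [nth 0 alpha r <= t]. *)
Definition powerful_array alpha A : Prop :=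
  [/\ shape A = alpha,
      (forall w, w \in A -> powersum_word w),
      (forall r s t x y, r < s -> entry A r t = Some x ->
         entry A s t = Some y -> (x < y)%O)
    & (forall r s t x y, r < s -> nth 0 alpha r <= t ->
         entry A r (nth 0 alpha r).-1 = Some x -> entry A s t = Some y ->
         (x < y)%O)].

Definition powT lambda T : Prop :=
  is_P_tableau lambda T /\
  exists alpha A, [/\ is_composition alpha, powerful_array alpha A & T = tab A].

Definition hook (a b : nat) : seq nat := a :: nseq b 1.

(** [behead (head [::] T)] is the first row of [T] without its first entry. *)
Definition keyT (a b : nat) T : Prop :=
  is_P_tableau (hook a b) T /\
  exists (i : 'I_b.+1) (x : P),
    entry T i 0 = Some x /\ powersum_word (x :: behead (head [::] T)).

End PTableaux.

Arguments three_plus_one_free {d} P.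

(* Main.v *)
Require Import Defs.
From mathcomp Require Import all_boot all_order.

(** Let c_0 < c_1 < ... < c_b be a chain and r a word. A powerful array whose
    shape sorts to a hook has a single row of arbitrary length, [c_p :: r], and
    all its other rows are singletons; pushing its columns up gives the hook
    tableau with first column c and first row [c_0 :: r], whatever the position
    p of the long row ([tab_hook_array]). Since the long row is a powersum word,
    powerful tableaux are key tableaux.

    Conversely, a key tableau names a c_i for which [c_i :: r] is a powersum
    word. Pushing r down to row p gives a powerful array as soon as [c_p :: r] is
    a powersum word and c_k lies below every letter of r for each k < p
    ([powerful_hook_array]). Take for p the first index before i such that c_p
    is not below every letter of r, or p = i if there is none
    ([exists_long_row]). If p < i then c_p < c_i inherits the powersum property
    of c_i ([powersum_cons_lt]): a descent from c_p to the first letter of r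
    would also be a descent from c_i, the conditions inside r are the same, and
    c_p is not a forbidden minimum by choice of p. *)

(** * Fillings with at most one row of length greater than 1 *)

Section HookArrays.

Set Implicit Arguments.
Unset Strict Implicit.

Variable T : Type.
Implicit Types (x y : T) (c r s : seq T) (A : seq (seq T)).

Definition hook_array c1 x r c2 : seq (seq T) :=
  [seq [:: z] | z <- c1] ++ (x :: r) :: [seq [:: z] | z <- c2].

Lemma shape_singletons c : shape [seq [:: z] | z <- c] = nseq (size c) 1.
Proof. by elim: c => //= z c <-. Qed.

Lemma shape_hook_array c1 x r c2 :
  shape (hook_array c1 x r c2) =
  nseq (size c1) 1 ++ (size r).+1 :: nseq (size c2) 1.
Proof. by rewrite -!shape_singletons /shape map_cat. Qed.

Lemma entry_lt_shape A i j x : entry A i j = Some x -> j < nth 0 (shape A) i.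
Proof.
rewrite /entry; elim: A i => [|s A IH] [|i] //=; last exact: IH.
by rewrite -onthTE => ->.
Qed.

Lemma entry_hook_array0 c1 x r c2 i :
  entry (hook_array c1 x r c2) i 0 = onth (c1 ++ x :: c2) i.
Proof.
elim: c1 i => [|z c1 IH] [|i] //=; last exact: IH.
by rewrite /entry /= onth_map; case: onth.
Qed.

Lemma entry_hook_arrayS c1 x r c2 i j :
  entry (hook_array c1 x r c2) i j.+1 =
  if i == size c1 then onth r j else None.
Proof.
elim: c1 i => [|z c1 IH] [|i] //=.
- by rewrite /entry /= onth_map; case: onth => //= ?; rewrite onth0n.
- by rewrite /entry /= onth0n.
- exact: IH.
Qed.

Lemma column_hook_array0 c1 x r c2 :
  column (hook_array c1 x r c2) 0 = c1 ++ x :: c2.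
Proof.
have colK c : pmap (fun s => onth s 0) [seq [:: z] | z <- c] = c.
  by elim: c => //= z c ->.
by rewrite /column /hook_array pmap_cat /= !colK.
Qed.

Lemma column_hook_arrayS c1 x r c2 j :
  column (hook_array c1 x r c2) j.+1 = seq_of_opt (onth r j).
Proof.
have col_nil c : pmap (fun s => onth s j.+1) [seq [:: z] | z <- c] = [::].
  by elim: c => //= z c ->; rewrite onth0n.
by rewrite /column /hook_array pmap_cat /= !col_nil; case: onth.
Qed.

Lemma pmap_onth_iota s : pmap (onth s) (iota 0 (size s)) = s.
Proof.
elim: s => //= z s IH; congr cons.
by rewrite -[1]/(1 + 0) iotaDl -[RHS]IH; elim: (iota _ _) => //= i l ->.
Qed.

Lemma singletons_onth s :
  [seq seq_of_opt (onth s i) | i <- iota 0 (size s)] = [seq [:: z] | z <- s].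
Proof.
elim: s => //= z s IH; congr cons.
by rewrite -[1]/(1 + 0) iotaDl -map_comp -[RHS]IH.
Qed.

Lemma sort_hook p q n :
  sort geq (nseq p 1 ++ n.+1 :: nseq q 1) = n.+1 :: nseq (p + q) 1.
Proof.
have geq_tr : transitive geq by move=> y x z /= yx zy; exact: leq_trans yx.
have geq_anti : antisymmetric geq.
  by move=> x y; rewrite /= andbC => /anti_leq.
apply: (sorted_eq geq_tr geq_anti).
- by apply: sort_sorted => x y; apply: leq_total.
- rewrite /=; elim: (p + q) n => [|m IH] k //=.
- rewrite perm_sort perm_catC /= -nseqD perm_cons addnC.
  exact: perm_refl.
Qed.

(** The position [size c1] of the long row is lost by [tab]. *)
Lemma tab_hook_array c1 x r c2 y c :
  c1 ++ x :: c2 = y :: c -> tab (hook_array c1 x r c2) = hook_array [::] y r c.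
Proof.
move=> def_c; have sz_c : size c1 + size c2 = size c.
  by move/(congr1 size): def_c; rewrite size_cat /= addnS => -[].
rewrite /tab shape_hook_array sort_hook sz_c /= size_nseq.
rewrite column_hook_array0 def_c /=; congr ((_ :: _) :: _).
  rewrite -[RHS]pmap_onth_iota -[1]/(1 + 0) iotaDl.
  elim: (iota _ _) => //= j l ->; rewrite column_hook_arrayS.
  by case: onth.
rewrite -singletons_onth -[1]/(1 + 0) iotaDl -map_comp.
apply/eq_in_map => i; rewrite mem_iota /= => lt_i.
rewrite nth_nseq lt_i /= column_hook_array0 def_c /=.
by case: onth.
Qed.

Lemma shape_nseq1 A n :
  shape A = nseq n 1 -> exists c, A = [seq [:: z] | z <- c].
Proof.
elim: A n => [|s A IH] [|n] //=; first by exists [::].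
case: s => [|z [|z' s]] //= [] /IH [c ->]; first by exists (z :: c).
Qed.

(** For [n = 0] all rows are singletons and the long row is chosen by [p]. *)
Lemma hook_arrayP A p n q :
  shape A = nseq p 1 ++ n.+1 :: nseq q 1 ->
  exists c1 x r c2, A = hook_array c1 x r c2.
Proof.
elim: p A => [|p IH] [|s A] //=.
  case: s => //= x r [_ /shape_nseq1[c ->]].
  by exists [::], x, r, c.
case: s => [|z [|z' s]] //= [] /IH [c1 [x [r [c2 ->]]]].
by exists (z :: c1), x, r, c2.
Qed.

End HookArrays.

(** * Powersum words and chains *)

Section Powersum.

Set Implicit Arguments.
Unset Strict Implicit.

Variables (d : Order.disp_t) (P : porderType d).
Implicit Types (x y z : P) (c r : seq P).

Lemma powersum1 x : powersum_word [:: x].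
Proof.
by split=> [[|i] y z //=|[i [y [//]]]]; rewrite ?onth0n.
Qed.

(** Lowering the first letter of a powersum word can only break the condition
    that this letter is not below all the others. *)
Lemma powersum_cons_lt x z r :
  (z < x)%O -> ~~ all (> z)%O r ->
  powersum_word (x :: r) -> powersum_word (z :: r).
Proof.
move=> lt_zx not_below [no_desc no_min]; split.
- case=> [|i] u v /=; last exact: (no_desc i.+1).
  case=> <- r0 lt_vz; apply: (no_desc 0 x v) => //.
  exact: Order.POrderTheory.lt_trans lt_zx.
- case=> -[|i] [u [lt_i /= ui u_min]].
    case: ui u_min => <- u_min; case/negP: not_below.
    by apply/allP => v /onthP[j rj]; apply: (u_min j.+1).
  apply: no_min; exists i.+1, u; split=> //.
  by case=> // j v lt_ij; apply: (u_min j.+1).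
Qed.

(** The decomposition of [c] locates the row to which [r] has to be pushed down:
    the last conjunct is what a powerful array asks of the singleton rows above
    its long row. *)
Lemma exists_long_row c x r :
  sorted <%O c -> x \in c -> powersum_word (x :: r) ->
  exists c1 z c2, [/\ c = c1 ++ z :: c2, powersum_word (z :: r)
    & forall y v, y \in c1 -> v \in r -> (y < v)%O].
Proof.
elim: c => //= y c IH lt_c; rewrite inE.
case: eqVneq => [-> _ x_psw|_ /= x_c x_psw].
  by exists [::], y, c.
have [below|not_below] := boolP (all (> y)%O r).
  have [c1 [z [c2 [-> z_psw c1_below]]]] := IH (path_sorted lt_c) x_c x_psw.
  exists (y :: c1), z, c2; split=> // u v.
  by rewrite inE => /predU1P[-> /(allP below)//|]; apply: c1_below.
exists [::], y, c; split=> //; apply: powersum_cons_lt not_below x_psw.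
exact: (allP (order_path_min Order.POrderTheory.lt_trans lt_c)).
Qed.

Lemma powerful_hook_array c1 x r c2 :
  sorted <%O (c1 ++ x :: c2) -> powersum_word (x :: r) ->
  (forall y v, y \in c1 -> v \in r -> (y < v)%O) ->
  powerful_array (nseq (size c1) 1 ++ (size r).+1 :: nseq (size c2) 1)
    (hook_array c1 x r c2).
Proof.
move=> lt_c x_psw c1_below; split; first exact: shape_hook_array.
- move=> w; rewrite mem_cat inE => /or3P[/mapP[z _ ->]|/eqP->//|/mapP[z _ ->]];
    exact: powersum1.
- move=> i k [|j] y z lt_ik; last first.
    (* Only the long row meets the columns other than column 0. *)
    rewrite !entry_hook_arrayS.
    by case: eqP lt_ik => // ->; case: ltngtP.
  rewrite !entry_hook_array0 => yi zk.
  rewrite -(onth_nth x _ _ _ yi) -(onth_nth x _ _ _ zk).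
  apply: (sorted_ltn_nth Order.POrderTheory.lt_trans) => //.
    by rewrite inE -onthTE yi.
  by rewrite inE -onthTE zk.
- move=> i k [|j] y z lt_ik.
    (* No row is empty, so none ends to the left of column 0. *)
    rewrite -(shape_hook_array c1 x r c2) leqn0.
    by move=> /eqP row0 yi; move: (entry_lt_shape yi); rewrite row0.
  rewrite entry_hook_arrayS => le_j yi; case: eqP => // k_eq zj.
  rewrite k_eq in lt_ik.
  rewrite nth_cat size_nseq lt_ik nth_nseq lt_ik /= entry_hook_array0 in yi.
  rewrite onth_cat lt_ik in yi.
  by apply: c1_below; apply/onthP; [exists i | exists j].
Qed.

End Powersum.

(** * Powerful and key tableaux of hook shape *)

Theorem lemma3p13 (d : Order.disp_t) (P : finPOrderType d) (a b : nat)
  (P_free : three_plus_one_free P) (a_gt0 : 0 < a) :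
  forall T : seq (seq P), powT (hook a b) T <-> keyT a b T.
Proof.
move=> T; split=> -[T_tab].
- case=> alpha [A [_ [shapeA rowsA _ _] def_T]].
  have sort_alpha : sort geq alpha = hook a b.
    by case: T_tab; rewrite def_T shape_tab shapeA.
  have [p [q def_alpha]] : exists p q, alpha = nseq p 1 ++ a :: nseq q 1.
    have alpha_hook : perm_eq alpha (hook a b).
      by rewrite -sort_alpha perm_sym; apply/permPl/perm_sort.
    have a_in : a \in alpha by rewrite (perm_mem alpha_hook) mem_head.
    case/splitPr: a_in alpha_hook => s1 s2.
    rewrite perm_catC /= perm_cons => /perm_mem s_eq.
    have ones s : {subset s <= s2 ++ s1} -> s = nseq (size s) 1.
      move=> s_sub; apply/all_pred1P/allP => m /s_sub.
      by rewrite s_eq mem_nseq => /andP[].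
    exists (size s1), (size s2); congr (_ ++ _ :: _); apply: ones => m m_in;
      by rewrite mem_cat m_in ?orbT.
  rewrite -(prednK a_gt0) in def_alpha.
  have [c1 [x [r [c2 def_A]]]] := hook_arrayP (etrans shapeA def_alpha).
  case def_c: (c1 ++ x :: c2) => [|y c]; first by case: (c1) def_c.
  rewrite def_A (tab_hook_array r def_c) in def_T.
  have sz_c : size c = b.
    case: T_tab; rewrite def_T /= shape_singletons => -[_ /(congr1 size)].
    by rewrite !size_nseq.
  have lt_c1 : size c1 < b.+1.
    rewrite -sz_c -[(size c).+1]/(size (y :: c)) -def_c size_cat /=.
    by rewrite addnS ltnS leq_addr.
  split=> //; exists (Ordinal lt_c1), x; split; rewrite def_T.
    by rewrite entry_hook_array0 /= -def_c onth_cat ltnn subnn.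
  by apply: rowsA; rewrite def_A mem_cat mem_head orbT.
- case=> i [x [xi x_psw]]; case: (T_tab) => shapeT colT _.
  have [y [r [c def_T]]] : exists y r c, T = hook_array [::] y r c.
    case: T shapeT {T_tab colT xi x_psw} => [|[|y r] T'] //= [].
      by move=> a0; rewrite -a0 in a_gt0.
    by move=> _ /shape_nseq1[c ->]; exists y, r, c.
  have colT0 k : entry T k 0 = onth (y :: c) k.
    by rewrite def_T entry_hook_array0.
  have lt_c : sorted <%O (y :: c).
    apply/(sortedP y) => k lt_k; apply: (colT k 0).
      by rewrite colT0 onthE (nth_map y) // ltnW.
    by rewrite colT0 onthE (nth_map y).
  have x_c : x \in y :: c by apply/onthP; exists i; rewrite -colT0.
  rewrite def_T /= in x_psw.
  have [c1 [z [c2 [def_c z_psw c1_below]]]] := exists_long_row lt_c x_c x_psw.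
  split=> //; exists (shape (hook_array c1 z r c2)), (hook_array c1 z r c2).
  split; last by rewrite def_T (tab_hook_array r (esym def_c)).
    by rewrite shape_hook_array /is_composition all_cat /= !all_nseq !orbT.
  by rewrite shape_hook_array; apply: powerful_hook_array; rewrite -?def_c.
Qed.
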